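(* Let $\mathcal{A}$ be a nearly associative algebra with left and right multiplication operators $L,R:\mathcal{A}\to\mathrm{End}(\mathcal{A})$. Then the following conditions are equivalent: (1) $(R^*,L^* )$ is a representation of $\mathcal{A}$ in $\mathcal{A}^*$; (2) $\mathcal{A}$ is an $L$-algebra; (3) $\mathcal{A}$ is an $R$-algebra.
   Context: All vector spaces are finite-dimensional over a field $\mathbb{K}$ of characteristic zero. An algebra (not necessarily associative) is nearly associative if $(xy)z=y(zx)$ for all $x,y,z$; it is an $L$-algebra if $x(yz)=y(xz)$ for all $x,y,z$, and an $R$-algebra if $(xy)z=(xz)y$ for all $x,y,z$. $L_x(y)=xy$, $R_x(y)=yx$, and $L^*,R^*:\mathcal{A}\to\mathrm{End}(\mathcal{A}^* )$ are defined by $L^*_x(f)=f\circ R_x$, $R^*_x(f)=f\circ L_x$. A pair of linear maps $r,l:\mathcal{A}\to\mathrm{End}(V)$ is a representation $(r,l)$ of the nearly associative algebra $\mathcal{A}$ in the vector space $V$ if $\mathcal{A}\oplus V$ with product $(x+u)\ast(y+v)=xy+l(x)(v)+r(y)(u)$ is a nearly associative algebra. *)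

(* Defs.v *)
From HB Require Import structures.
From mathcomp Require Import all_boot all_order all_algebra.

Set Implicit Arguments.
Unset Strict Implicit.
Unset Printing Implicit Defensive.

Import GRing.Theory.
Local Open Scope ring_scope.

(* MathComp's algebra structures are all associative, so a finite-dimensional
   (nonassociative) algebra over K is a vectType K together with a bilinear
   product. *)

Section Identities.
Variables (K : fieldType) (A : vectType K) (mul : {bilinear A -> A -> A}).

Definition nearly_associative : Prop :=
  forall x y z : A, mul (mul x y) z = mul y (mul z x).

Definition L_algebra : Prop :=
  forall x y z : A, mul x (mul y z) = mul y (mul x z).

Definition R_algebra : Prop :=
  forall x y z : A, mul (mul x y) z = mul (mul x z) y.

End Identities.

(* The product on A (+) V, realised as the type A * V:
   (x + u) * (y + v) = xy + l(x)(v) + r(y)(u). *)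
Section Semidirect.
Variables (K : fieldType) (A V : vectType K) (mul : {bilinear A -> A -> A}).
Variables (r l : {linear A -> 'End(V)}).

Definition semidirect_mul (p q : A * V) : A * V :=
  (mul p.1 q.1, l p.1 q.2 + r q.1 p.2).

Fact semidirect_mul_is_bilinear : bilinear_for *:%R *:%R semidirect_mul.
Proof.
split=> [q|p] a u v; rewrite /semidirect_mul /=; congr (_, _).
- by rewrite linearPl.
- rewrite -[RHS]/(a *: (l u.1 q.2 + r q.1 u.2) + (l v.1 q.2 + r q.1 v.2)).
  by rewrite !linearP add_lfunE scale_lfunE scalerDr addrACA.
- by rewrite linearPr.
- rewrite -[RHS]/(a *: (l p.1 u.2 + r u.1 p.2) + (l p.1 v.2 + r v.1 p.2)).
  by rewrite !linearP add_lfunE scale_lfunE scalerDr addrACA.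
Qed.

HB.instance Definition _ :=
  bilinear_isBilinear.Build K _ _ _ *:%R *:%R semidirect_mul
    semidirect_mul_is_bilinear.

Definition is_representation : Prop := nearly_associative semidirect_mul.

End Semidirect.

Section DualOperators.
Variables (K : fieldType) (A : vectType K) (mul : {bilinear A -> A -> A}).

Definition Lop (x : A) : 'End(A) := linfun (mul x).
Definition Rop (x : A) : 'End(A) := linfun (applyr mul x).

Definition precomp (g : 'End(A)) (f : 'Hom(A, K^o)) : 'Hom(A, K^o) :=
  (f \o g)%VF.

Fact precomp_is_linear (g : 'End(A)) : linear (precomp g).
Proof. by move=> a f h; rewrite /precomp comp_lfunDl comp_lfunZl. Qed.

(* linfun is meaningful only on linear maps; the linearity instances below make
   this hold and let Ldual and Rdual be used as linear maps A -> End(A^* ). *)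
HB.instance Definition _ (g : 'End(A)) :=
  GRing.isLinear.Build K _ _ *:%R (precomp g) (precomp_is_linear g).

(* L^*_x (f) = f o R_x and R^*_x (f) = f o L_x: each dual operator
   precomposes with the multiplication on the opposite side. *)
Definition Ldual (x : A) : 'End('Hom(A, K^o)) := linfun (precomp (Rop x)).
Definition Rdual (x : A) : 'End('Hom(A, K^o)) := linfun (precomp (Lop x)).

Lemma LopE x y : Lop x y = mul x y. Proof. exact: lfunE. Qed.
Lemma RopE x y : Rop x y = mul y x. Proof. exact: lfunE. Qed.

Lemma LdualE x f y : Ldual x f y = f (mul y x).
Proof. by rewrite /Ldual lfunE /= /precomp comp_lfunE RopE. Qed.

Lemma RdualE x f y : Rdual x f y = f (mul x y).
Proof. by rewrite /Rdual lfunE /= /precomp comp_lfunE LopE. Qed.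

Fact Ldual_is_linear : linear Ldual.
Proof.
move=> a x y; apply/lfunP=> f; apply/lfunP=> z.
by rewrite !(add_lfunE, scale_lfunE) !LdualE linearPr linearP.
Qed.

Fact Rdual_is_linear : linear Rdual.
Proof.
move=> a x y; apply/lfunP=> f; apply/lfunP=> z.
by rewrite !(add_lfunE, scale_lfunE) !RdualE linearPl linearP.
Qed.

HB.instance Definition _ :=
  GRing.isLinear.Build K _ _ *:%R Ldual Ldual_is_linear.
HB.instance Definition _ :=
  GRing.isLinear.Build K _ _ *:%R Rdual Rdual_is_linear.

End DualOperators.

(* Main.v *)
Require Import Defs.
From HB Require Import structures.
From mathcomp Require Import all_boot all_order all_algebra.

Set Implicit Arguments.
Unset Strict Implicit.
Unset Printing Implicit Defensive.

Import GRing.Theory.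
Local Open Scope ring_scope.

(** Near associativity of the semidirect product is, on the [A^*] component, an equality of
    functionals linear in three independent functionals. It therefore splits into one identity per
    functional: the L-identity, the R-identity, and near associativity of [A] itself. Under near
    associativity the first two are equivalent, so any one of the three conditions yields the
    others. *)

(** The coordinate functionals of a basis already determine a vector. *)
Lemma dual_separates (K : fieldType) (V : vectType K) (u v : V) :
  (forall f : 'Hom(V, K^o), f u = f v) -> u = v.
Proof.
move=> eq_f; rewrite (coord_vbasis (memvf u)) (coord_vbasis (memvf v)).
apply: eq_bigr => i _; congr (_ *: _).
by have := eq_f (linfun (coord (vbasis fullv) i : V -> K^o)); rewrite !lfunE.
Qed.

(** Near associativity turns [(xy)z] and [(xz)y] into [y(zx)] and [z(yx)], so swapping the two right
    factors on one side is swapping the two left factors on the other. *)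
Lemma L_algebra_iff_R_algebra (K : fieldType) (A : vectType K)
    (mul : {bilinear A -> A -> A}) :
  nearly_associative mul -> L_algebra mul <-> R_algebra mul.
Proof.
move=> nassoc; split=> LR x y z; first by rewrite !nassoc LR.
by rewrite -!nassoc LR.
Qed.

Lemma dual_semidirectE (K : fieldType) (A : vectType K)
    (mul : {bilinear A -> A -> A}) (p q : A * 'Hom(A, K^o)) (w : A) :
  (semidirect_mul mul (Rdual mul) (Ldual mul) p q).2 w =
    q.2 (mul w p.1) + p.2 (mul q.1 w).
Proof. by rewrite /semidirect_mul add_lfunE LdualE RdualE. Qed.

(* Evaluating the A^*-component of near associativity at w separates into
   h(w(xy)) = h(x(wy)), g((zw)x) = g((zx)w) and f(y(zw)) = f((wy)z);
   the last holds because A is nearly associative. *)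
Lemma dual_representationP (K : fieldType) (A : vectType K)
    (mul : {bilinear A -> A -> A}) :
  nearly_associative mul ->
  is_representation mul (Rdual mul) (Ldual mul) <->
    L_algebra mul /\ R_algebra mul.
Proof.
move=> nassoc; split=> [rep | [Lalg Ralg]].
  suff Lalg : L_algebra mul by split=> //; apply/(L_algebra_iff_R_algebra nassoc).
  move=> w x y; apply: dual_separates => h.
  pose ev (p : A * 'Hom(A, K^o)) := p.2 w.
  (* Zero functionals in the first two arguments leave only the [h] terms, which give
     [h(w(xy)) = h(x(wy))]. *)
  have := congr1 ev (rep (x, 0) (y, 0) (0, h)); rewrite /ev.
  by rewrite !dual_semidirectE ![_.1]/= ![_.2]/= !zero_lfunE !addr0 !add0r.
case=> [x f] [y g] [z h]; apply: injective_projections; first exact: nassoc.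
apply/lfunP=> w; rewrite !dual_semidirectE ![_.1]/= ![_.2]/=.
rewrite (Lalg w x y) (Ralg z w x) (nassoc w y z).
by rewrite addrA addrAC [X in X + _]addrC.
Qed.

Theorem proposition3p9 (K : fieldType) (charK : [pchar K] =i pred0)
    (A : vectType K) (mul : {bilinear A -> A -> A})
    (nassoc : nearly_associative mul) :
  [<-> is_representation mul (Rdual mul) (Ldual mul);
       L_algebra mul;
       R_algebra mul].
Proof.
tfae.
- by case/(dual_representationP nassoc).
- by move/(L_algebra_iff_R_algebra nassoc).
- move=> Ralg; apply/(dual_representationP nassoc); split=> //.
  exact/(L_algebra_iff_R_algebra nassoc).
Qed.
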